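(* Let $n\ge 1$ and let $G$ be a simple graph with node set $[n]$ and edge set $E(G)$. Then $$\chi(G)=\min\left\{k\in\mathbb{N} : \mathrm{CPM}_k^n(S_G)\neq\emptyset\right\}$$ and $$\chi(G)=\min\left\{\operatorname{tr}(\mathbf{R}) : \mathbf{R}=(r_{ij})=(\mathbf{r}_1,\ldots,\mathbf{r}_n)\in\mathbb{R}^{n\times n},\ \begin{array}{l}\mathbf{r}_i\in\Delta^n\ \text{ for all } i\in[n],\\ r_{ij}=0\ \text{ for all } (i,j)\in E(G),\\ r_{ij}\cdot(\mathbf{r}_i-\mathbf{r}_j)=\mathbf{0}\ \text{ for all } i,j\in[n],\\ \mathbf{R}=\mathbf{R}^\top\end{array}\right\}.$$
   Context: $[n]=\{1,\dots,n\}$. The chromatic number $\chi(G)$ is the smallest $k$ such that $[n]$ can be partitioned into $k$ (nonempty) stable sets of $G$, where a stable set is a subset of nodes inducing no edges. $S_G\subseteq 2^{[n]}$ denotes the set of all stable sets of $G$. The standard simplex is $\Delta^n=\{\mathbf{x}\in\mathbb{R}^n : \mathbf{x}\ge \mathbf{0},\ \sum_i x_i=1\}$, and $\Delta^n_{S_G}=\{\mathbf{r}\in\Delta^n : \operatorname{supp}(\mathbf{r})\in S_G\}$, where $\operatorname{supp}(\mathbf{r})$ is the set of indices of nonzero entries. For a matrix $\mathbf{R}=(r_{ij})\in\mathbb{R}^{n\times n}$, $\mathbf{r}_1,\dots,\mathbf{r}_n$ denote its columns. The set of combinatorial projection matrices $\mathrm{CPM}_k^n(S_G)$ is the set of all $\mathbf{R}\in\mathbb{R}^{n\times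 n}$ such that every column $\mathbf{r}_i$ lies in $\Delta^n_{S_G}$; $r_{ij}\cdot(\mathbf{r}_i-\mathbf{r}_j)=\mathbf{0}$ for all $i,j\in[n]$; $\mathbf{R}=\mathbf{R}^\top$; and $\operatorname{tr}(\mathbf{R})=k$. *)

(* Defs.v *)
From mathcomp Require Import all_boot all_order all_algebra.
From mathcomp Require Import all_classical reals.

Set Implicit Arguments.
Unset Strict Implicit.
Unset Printing Implicit Defensive.

Import Order.TTheory GRing.Theory Num.Theory.

Local Open Scope classical_set_scope.

(* MathComp's 'I_n = {0, ..., n-1} plays the role of [n] = {1, ..., n}. *)
Record simple_graph (n : nat) := SimpleGraph {
  edge : rel 'I_n;
  edge_sym : symmetric edge;
  edge_irr : irreflexive edge
}.

Definition stable_sets (n : nat) (G : simple_graph n) : {set {set 'I_n}} :=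
  [set A : {set 'I_n} | [forall i in A, forall j in A, ~~ edge G i j]]%SET.

(* [finset.partition], unlike [classical_sets.partition], is about finite sets;
   it already requires the blocks to be nonempty. *)
Definition stable_partitionable (n : nat) (G : simple_graph n) (k : nat) : bool :=
  [exists P : {set {set 'I_n}},
    [&& finset.partition P [set: 'I_n]%SET,
        P \subset stable_sets G & #|P| == k]].

Lemma ex_stable_partitionable (n : nat) (G : simple_graph n) :
  exists k, stable_partitionable G k.
Proof.
pose P := preim_partition (@id 'I_n) [set: 'I_n]%SET.
exists #|P|; apply/existsP; exists P; rewrite eqxx preim_partitionP /= andbT.
apply/fintype.subsetP => _ /imsetP[x _ ->]; rewrite inE.
apply/forall_inP => i; rewrite !inE /= => /eqP <-.
by apply/forall_inP => j; rewrite !inE /= => /eqP <-; rewrite edge_irr.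
Qed.

Definition chromatic_number (n : nat) (G : simple_graph n) : nat :=
  ex_minn (ex_stable_partitionable G).

Definition is_min d (T : porderType d) (A : set T) (m : T) : Prop :=
  A m /\ lbound A m.

Local Open Scope ring_scope.

Definition simplex (R : realType) (n : nat) : set 'cV[R]_n :=
  [set r | (forall i, 0 <= r i 0) /\ \sum_i r i 0 = 1].

Definition supp (R : realType) (n : nat) (r : 'cV[R]_n) : {set 'I_n} :=
  [set i | r i 0 != 0]%SET.

Definition simplex_on (R : realType) (n : nat) (S : {set {set 'I_n}}) :
    set 'cV[R]_n :=
  [set r | simplex r /\ supp r \in S].

Definition CPM (R : realType) (n : nat) (S : {set {set 'I_n}}) (k : nat) :
    set 'M[R]_n :=
  [set M | [/\ forall i, simplex_on S (col i M),
               forall i j, M i j *: (col i M - col j M) = 0,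
               M = M^T
             & \tr M = k%:R]].
Arguments CPM : clear implicits.

(* Main.v *)
Require Import Defs.
From mathcomp Require Import all_boot all_order all_algebra.
From mathcomp Require Import all_classical reals.

(** The matrices in both minimization problems are exactly the averaging
    matrices of partitions: to a partition P of the nodes corresponds the
    symmetric matrix that averages a vector over each block of P, and its trace
    is the number of blocks, because a block B contributes #|B| diagonal
    entries equal to 1 / #|B| ([mxtrace_block_avg]).

    Conversely, let M be symmetric with stochastic columns r_i and with
    M i j *: (r_i - r_j) = 0.  Some entry M i j of column i is nonzero, hence
    r_i = r_j, and reading row i gives M i i = M i j != 0.  From this,
    M i j != 0 holds exactly when r_i = r_j, and then M i j = M i i.  So the
    support of column i is the class of i for the equivalence relation
    r_i = r_j; the entries of the column are constant on this support and sum
    to 1, so M averages over the classes of that relation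
    ([projection_block_avg]).

    If M vanishes on the edges, then these classes are stable; conversely the
    averaging matrix of a partition into stable sets has stable column
    supports.  The possible traces are therefore the numbers of blocks of the
    partitions into stable sets, and the least one is the chromatic number. *)

Set Implicit Arguments.
Unset Strict Implicit.
Unset Printing Implicit Defensive.

Import Order.TTheory GRing.Theory Num.Theory.

Local Open Scope classical_set_scope.
Local Open Scope ring_scope.

Lemma partition_setT_pblock (T : finType) (P : {set {set T}}) (x : T) :
  finset.partition P [set: T]%SET ->
  (x \in finset.pblock P x) && (finset.pblock P x \in P).
Proof.
move=> partP; have xP : x \in finset.cover P.
  by rewrite (finset.cover_partition partP) inE.
by rewrite finset.mem_pblock xP pblock_mem.
Qed.

Definition block_avg (R : realType) (n : nat) (P : {set {set 'I_n}}) :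
    'M[R]_n :=
  \matrix_(i, j) if j \in finset.pblock P i then #|finset.pblock P i|%:R^-1 else 0.
Arguments block_avg : clear implicits.

Section BlockAverage.
Variables (R : realType) (n : nat) (P : {set {set 'I_n}}).
Hypothesis partP : finset.partition P [set: 'I_n]%SET.

Let tiP : finset.trivIset P := partition_trivIset partP.

Lemma pblock_sym (i j : 'I_n) : (i \in finset.pblock P j) = (j \in finset.pblock P i).
Proof.
have cov k : k \in finset.cover P by rewrite (finset.cover_partition partP) inE.
by rewrite -!eq_pblock // eq_sym.
Qed.

Lemma block_avg_sym : block_avg R n P = (block_avg R n P)^T.
Proof.
apply/matrixP => i j; rewrite !mxE pblock_sym.
by case: ifP => // ij; rewrite (same_pblock tiP ij).
Qed.

Lemma card_pblock_neq0 (i : 'I_n) : #|finset.pblock P i|%:R != 0 :> R.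
Proof.
rewrite pnatr_eq0 -lt0n; apply/card_gt0P; exists i.
by case/andP: (partition_setT_pblock i partP).
Qed.

Lemma col_block_avgE (i j : 'I_n) :
  col i (block_avg R n P) j 0 =
    if j \in finset.pblock P i then #|finset.pblock P i|%:R^-1 else 0.
Proof. by rewrite block_avg_sym !mxE. Qed.

Lemma simplex_col_block_avg (i : 'I_n) : simplex (col i (block_avg R n P)).
Proof.
split=> [j|]; first by rewrite col_block_avgE; case: ifP; rewrite ?invr_ge0.
rewrite (eq_bigr _ (fun j _ => col_block_avgE i j)) -big_mkcond sumr_const.
by rewrite -[_ *+ _]mulr_natl divff ?card_pblock_neq0.
Qed.

Lemma supp_col_block_avg (i : 'I_n) :
  supp (col i (block_avg R n P)) = finset.pblock P i.
Proof.
apply/setP => j; rewrite inE col_block_avgE.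
by case: ifP => _; rewrite ?eqxx // invr_eq0 card_pblock_neq0.
Qed.

Lemma block_avg_proj (i j : 'I_n) :
  block_avg R n P i j *:
    (col i (block_avg R n P) - col j (block_avg R n P)) = 0.
Proof.
rewrite mxE; case: ifP => [ji|_]; last by rewrite scale0r.
rewrite [X in _ *: X](_ : _ = 0) ?scaler0 //; apply/eqP; rewrite subr_eq0.
by apply/eqP/matrixP => k z; rewrite ord1 !col_block_avgE (same_pblock tiP ji).
Qed.

Lemma mxtrace_block_avg : \tr (block_avg R n P) = #|P|%:R.
Proof.
have -> : \tr (block_avg R n P) =
    \sum_(i in [set: 'I_n]%SET) #|finset.pblock P i|%:R^-1.
  apply: eq_big => [i|i _]; first by rewrite inE.
  rewrite mxE.
  by case/andP: (partition_setT_pblock i partP) => ->.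
rewrite (set_partition_big P partP) -sumr_const; apply: eq_bigr => B PB.
rewrite (eq_bigr (fun=> #|B|%:R^-1)); last first.
  by move=> i iB; rewrite (def_pblock tiP PB iB).
rewrite sumr_const -[_ *+ _]mulr_natl divff // pnatr_eq0 cards_eq0.
exact: partition_neq0 partP PB.
Qed.

Lemma block_avg_CPM (S : {set {set 'I_n}}) :
  P \subset S -> CPM R n S #|P| (block_avg R n P).
Proof.
move=> /fintype.subsetP PS; split=> [i|i j||].
- split; first exact: simplex_col_block_avg.
  by rewrite supp_col_block_avg PS //; case/andP: (partition_setT_pblock i partP).
- exact: block_avg_proj.
- exact: block_avg_sym.
- exact: mxtrace_block_avg.
Qed.

End BlockAverage.

Section Projections.
Variables (R : realType) (n : nat) (M : 'M[R]_n).
Hypothesis simplexM : forall i, simplex (col i M).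
Hypothesis projM : forall i j, M i j *: (col i M - col j M) = 0.
Hypothesis symM : M = M^T.

Lemma projection_entry_neq0 (i j : 'I_n) :
  M i j != 0 -> col i M = col j M.
Proof.
move=> ij; have /eqP := projM i j.
by rewrite scaler_eq0 (negPf ij) subr_eq0 => /eqP.
Qed.

Lemma projection_eq_col (i j : 'I_n) : col i M = col j M -> M i j = M i i.
Proof. by move/matrixP/(_ i 0); rewrite !mxE. Qed.

(** Column i sums to 1, so M i j != 0 for some j; then columns i and j agree,
    and their entries in row i are M i i and M i j. *)
Lemma projection_diag_neq0 (i : 'I_n) : M i i != 0.
Proof.
have [j ji] : exists j, M j i != 0.
  apply/existsP; apply: contraT; rewrite negb_exists => /forallP M0.
  have [_ /eqP] := simplexM i; rewrite big1 ?(eq_sym 0) ?oner_eq0 // => j _.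
  by rewrite mxE; apply/eqP/negPn/M0.
have ij : M i j != 0 by rewrite symM mxE.
by rewrite -(projection_eq_col (projection_entry_neq0 ij)).
Qed.

Definition col_classes : {set {set 'I_n}} :=
  preim_partition (fun i => col i M) [set: 'I_n]%SET.

Lemma col_classesP : finset.partition col_classes [set: 'I_n]%SET.
Proof. exact: preim_partitionP. Qed.

(** The support of a column is a class of equal columns: equal columns have
    equal, nonzero, entries in row i because the diagonal does not vanish. *)
Lemma mem_col_classes (i j : 'I_n) :
  (j \in finset.pblock col_classes i) = (M i j != 0).
Proof.
rewrite pblock_equivalence_partition ?inE //; last first.
  by split=> // /eqP->.
apply/eqP/idP => [ij|]; last exact: projection_entry_neq0.
by rewrite projection_eq_col ?projection_diag_neq0.
Qed.

Lemma projection_block_avg : M = block_avg R n col_classes.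
Proof.
have row_const i j : M i j = if j \in finset.pblock col_classes i then M i i else 0.
  rewrite mem_col_classes; case: eqP => //= /eqP ij.
  exact/projection_eq_col/projection_entry_neq0.
apply/matrixP => i j; rewrite mxE row_const; case: ifP => // _.
(* By symmetry column i is also row i, which is constant on the class of i:
     the column sum 1 is the size of the class times the diagonal entry. *)
have [_ sum1] := simplexM i.
have : #|finset.pblock col_classes i|%:R * M i i = 1.
  rewrite mulr_natl -sumr_const big_mkcond -sum1; apply: eq_bigr => k _.
  by rewrite -row_const mxE {1}symM mxE.
move=> card_diag; apply: (mulfI (card_pblock_neq0 R col_classesP i)).
by rewrite card_diag divff // card_pblock_neq0 //; exact: col_classesP.
Qed.

End Projections.

Lemma chromatic_numberP (n : nat) (G : simple_graph n) :
  exists P : {set {set 'I_n}},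
    [/\ finset.partition P [set: 'I_n]%SET, P \subset stable_sets G
      & #|P| = chromatic_number G].
Proof.
rewrite /chromatic_number; case: ex_minnP => k /existsP[P /and3P[? ? /eqP ?]] _.
by exists P.
Qed.

Lemma chromatic_number_min (n : nat) (G : simple_graph n) (P : {set {set 'I_n}}) :
  finset.partition P [set: 'I_n]%SET -> P \subset stable_sets G ->
  (chromatic_number G <= #|P|)%N.
Proof.
move=> partP stP; rewrite /chromatic_number; case: ex_minnP => k _; apply.
by apply/existsP; exists P; rewrite partP stP eqxx.
Qed.

Definition edge_free_projections (R : realType) (n : nat) (G : simple_graph n) :
    set 'M[R]_n :=
  [set M : 'M[R]_n |
    [/\ forall i, simplex (col i M),
        forall i j, edge G i j -> M i j = 0,
        forall i j, M i j *: (col i M - col j M) = 0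
      & M = M^T]].

(** If M i j != 0, then i and j both lie in the support of column j, since the
    diagonal of M does not vanish; that support being stable, i and j are not
    adjacent. *)
Lemma CPM_edge_free (R : realType) (n : nat) (G : simple_graph n) (k : nat)
    (M : 'M[R]_n) :
  CPM R n (stable_sets G) k M -> edge_free_projections G M.
Proof.
move=> [spM projM symM _].
have simplexM i : simplex (col i M) by case: (spM i).
split=> // i j ij; apply/eqP; apply: contraLR ij => Mij.
have [_] := spM j; rewrite inE => /forall_inP/(_ i); rewrite !inE !mxE.
move=> /(_ Mij)/forall_inP; apply.
by rewrite inE mxE (projection_diag_neq0 simplexM projM symM).
Qed.

Lemma chromatic_number_le_mxtrace (R : realType) (n : nat) (G : simple_graph n)
    (M : 'M[R]_n) :
  edge_free_projections G M -> (chromatic_number G)%:R <= \tr M.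
Proof.
move=> [simplexM edgeM projM symM].
have partM := col_classesP M.
rewrite (projection_block_avg simplexM projM symM) (mxtrace_block_avg _ partM).
rewrite ler_nat; apply: chromatic_number_min => //.
have ti := partition_trivIset partM.
apply/fintype.subsetP => B PB; rewrite inE.
apply/forall_inP => i iB; apply/forall_inP => j jB.
have : j \in finset.pblock (col_classes M) i by rewrite (def_pblock ti PB iB).
rewrite (mem_col_classes simplexM projM symM).
by apply: contraNN => /edgeM ->.
Qed.

Theorem theorem14 (R : realType) (n : nat) (hn : (1 <= n)%N)
    (G : simple_graph n) :
  is_min [set k : nat | CPM R n (stable_sets G) k !=set0]
    (chromatic_number G)
  /\
  is_min
    [set \tr M | M in
      [set M : 'M[R]_n |
        [/\ forall i, simplex (col i M),
            forall i j, edge G i j -> M i j = 0,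
            forall i j, M i j *: (col i M - col j M) = 0
          & M = M^T]]]
    (chromatic_number G)%:R.
Proof.
have [P [partP stP cardP]] := chromatic_numberP G.
have cpmP := block_avg_CPM R partP stP.
split; split.
- by exists (block_avg R n P); rewrite -cardP.
- move=> k [M cpmM]; have [_ _ _ trM] := cpmM.
  have := chromatic_number_le_mxtrace (CPM_edge_free cpmM).
  by rewrite trM ler_nat.
- exists (block_avg R n P); first exact: CPM_edge_free cpmP.
  by rewrite -cardP mxtrace_block_avg.
- by move=> _ [M projM <-]; exact: chromatic_number_le_mxtrace.
Qed.
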